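(* Let $m,n\geq 1$, let $d_1,\dots,d_m,p_1,\dots,p_n$ be pairwise distinct primes, let $a_1,\dots,a_n$ be positive integers, and put $d=d_1\cdots d_m$. Then the following are equivalent. (i) There exists a finite metabelian group $G$ with $|G|=d_1\cdots d_m\,p_1^{a_1}\cdots p_n^{a_n}$ such that $d\in\mathrm{cd}(G)$. (ii) There exist a positive integer $k\leq m$, positive integers $\epsilon_1,\dots,\epsilon_k$, positive integers $b_1,\dots,b_k$, and primes $q_1,\dots,q_k$ (not necessarily distinct) such that $$q_r^{\epsilon_r}\equiv 1 \pmod{b_r}\quad\text{for every } 1\leq r\leq k,$$ $$b_1\cdots b_k=d,\qquad\text{and}\qquad q_1^{\epsilon_1}\cdots q_k^{\epsilon_k}\ \text{ divides }\ p_1^{a_1}\cdots p_n^{a_n}.$$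
   Context: All groups are finite. For a finite group $G$, $\mathrm{Irr}(G)$ denotes the set of irreducible complex characters of $G$, and $\mathrm{cd}(G)=\{\chi(1) : \chi\in\mathrm{Irr}(G)\}$ is the set of irreducible character degrees of $G$. A group is metabelian if its derived subgroup is abelian. The primes $q_1,\dots,q_k$ may repeat; the divisibility condition concerns the full product $q_1^{\epsilon_1}\cdots q_k^{\epsilon_k}$, with repeated factors counted with multiplicity. The integers $b_r$ are not required to be prime. *)

(* Defs.v *)
From mathcomp Require Import all_boot all_order all_algebra all_fingroup.
From mathcomp Require Import all_solvable all_field all_character.

Set Implicit Arguments.
Unset Strict Implicit.
Unset Printing Implicit Defensive.

Import GRing.Theory Num.Theory.

Definition metabelian (gT : finGroupType) (G : {group gT}) : bool :=
  abelian G^`(1)%g.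

(* Characters take values in algC, the algebraic complex numbers, which loses
   nothing for finite groups. *)
Definition cd (gT : finGroupType) (G : {group gT}) : {pred nat} :=
  [pred d : nat | [exists i : Iirr G, ('chi_i 1%g == d%:R)%R]].

(* Main.v *)
Require Import Defs.
From mathcomp Require Import all_boot all_order all_algebra all_fingroup.
From mathcomp Require Import all_solvable all_field all_character.

Set Implicit Arguments.
Unset Strict Implicit.
Unset Printing Implicit Defensive.

(** Write [D] for the product of the [d i] and [P] for the product of the
    [p j ^ a j]; they are coprime.

    Let [G] be metabelian of order [D * P] with an irreducible character of
    degree [D].  By Ito's theorem ([dvd_irr1_index_abelian]) [D] divides
    [#|G : M|], that is [#|M|] divides [P], for every abelian normal subgroup
    [M].  For [M = A := G^`(1)] this makes a Hall subgroup [H] of order [D]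
    meet [A] trivially, so [H] is abelian; for [M = A <*> 'C_H(A)] it forces
    [H] to act faithfully on [A].  So an abelian group of order [D] acts
    faithfully and coprimely on an abelian group of order dividing [P]
    ([metabelian_coprime_degree]).  Take a minimal [H]-invariant subgroup [N] of
    [A]: it is elementary abelian, and since [H] is abelian, [H / 'C_H(N)] acts
    on it without nontrivial fixed points, hence has order [b] dividing
    [#|N| - 1].  By coprimality [C = 'C_H(N)] is still faithful on [A / N], and
    induction on [#|A|] cuts [D] into such factors [b], with the product of the
    [#|N|] dividing [#|A|] ([coprime_abelian_factors]).  Keeping only the
    factors [b > 1], there are at most [m] of them, as [D] is a product of [m]
    primes ([size_factorization_le]).

    Conversely, if [b > 1] divides [q ^ e - 1], the multiplicative subgroup of
    order [b] of the field with [q ^ e] elements acts without fixed points on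
    the additive group.  Inducing a nontrivial linear character of the kernel
    of the resulting Frobenius group gives an irreducible character of degree
    [b] ([affine_realizable]).  A direct product of such groups, and of a cyclic
    group that supplies the missing part of [P], has order [D * P] and an
    irreducible character of degree [D]. *)

Import GroupScope GRing.Theory Num.Theory.
Local Open Scope ring_scope.

(** * From a character to a coprime action *)

(** Ito's theorem.  By Clifford theory the character is induced from a
    constituent [s] of the inertia group [T] of a linear constituent [t] of its
    restriction to [A].  The restriction of [s] to [A] is a multiple of [t], so
    [A] lies in the center of [s] and the degree of [s] divides [#|T : A|]. *)
Lemma dvd_irr1_index_abelian (gT : finGroupType) (G A : {group gT})
    (i : Iirr G) :
  A <| G -> abelian A -> ('chi_i 1%g %| #|G : A|)%C.
Proof.
move=> nsAG abA; have [sAG nAG] := andP nsAG.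
have [t tA] := constt_cfRes_irr A i.
have [_ _ AtoB _ _] := constt_Inertia_bijection t nsAG.
have: i \in irr_constt ('Ind[G] 'chi_t) by rewrite constt_Ind_Res.
rewrite -AtoB => /imsetP[s sT Di].
have [irrInd _ _ _ _] := constt_Inertia_bijection t nsAG.
set T := 'I_G['chi_t]%G in s sT Di irrInd.
have sTG: T \subset G := Inertia_sub G _.
have nsAT: A <| T := normal_Inertia 'chi_t sAG.
have sAT := normal_sub nsAT.
have ->: 'chi_i = 'Ind[G] 'chi_s by rewrite Di cfIirrE ?irrInd.
rewrite cfInd1 // -(Lagrange_index sTG sAT) nCdivE natrM.
rewrite dvdC_mul2l ?pnatr_eq0 -?lt0n ?indexg_gt0 //.
apply: dvdC_trans (dvd_irr1_index_center s) _.
rewrite dvdC_nat indexgS //.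
apply/subsetP=> x Ax; rewrite irr_cfcenterE ?(subsetP sAT) //.
rewrite constt_Ind_Res in sT.
have DpsiA: 'Res[A] 'chi_s = '['Res[A] 'chi_s, 'chi_t] *: 'chi_t.
  rewrite {1}(Clifford_Res_sum_cfclass nsAT sT).
  by rewrite cfclass_invariant ?subsetIr ?big_seq1.
have lin_t: 'chi_t \is a linear_char by apply/char_abelianP.
rewrite -!(cfResE _ sAT) // DpsiA !cfunE normrM normC_lin_char // lin_char1 //.
rewrite !mulr1 ger0_norm // natr_ge0 // Cnat_cfdot_char_irr //.
by rewrite cfRes_char ?irr_char.
Qed.

Local Open Scope nat_scope.

(** By Ito's theorem an abelian normal subgroup of [G] has order dividing [P], so
    it meets a Hall subgroup [H] of order [d] trivially.  With [A = G^`(1)], this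
    kills [H^`(1)], which lies in [A], and ['C_H(A)], which lies in the abelian
    normal subgroup [A <*> 'C_H(A)]. *)
Lemma metabelian_coprime_degree (gT : finGroupType) (G : {group gT}) d P :
    metabelian G -> #|G| = d * P -> coprime d P -> d \in cd G ->
  exists A H : {group gT},
    [/\ abelian A /\ abelian H, H \subset 'N(A),
        #|H| = d, #|A| %| P & 'C_H(A) = 1%g].
Proof.
move=> abA cardG coP /existsP[i /eqP Di].
have [d_gt0 P_gt0]: 0 < d /\ 0 < P.
  by apply/andP; rewrite -muln_gt0 -cardG cardG_gt0.
have ito (M : {group gT}): M <| G -> abelian M -> #|M| %| P.
  move=> nsMG abM; have := dvd_irr1_index_abelian i nsMG abM.
  rewrite Di dvdC_nat => /dvdnP[c Dc]; rewrite -(dvdn_pmul2l d_gt0) -cardG.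
  by rewrite -(Lagrange (normal_sub nsMG)) Dc mulnC dvdn_mul // dvdn_mull.
have nsAG : G^`(1)%G <| G := der_normal 1 G.
have A_P := ito _ nsAG abA.
have solG: solvable G.
  by rewrite (series_sol nsAG) (abelian_sol abA) abelian_sol ?der_abelian.
have [H hallH _] := Hall_exists_subJ \pi(d) solG.
have sHG := pHall_sub hallH.
have cardH: #|H| = d.
  rewrite (card_Hall hallH) cardG partnM // part_pnat_id ?pnat_pi //.
  by rewrite part_p'nat ?muln1 // -coprime_pi'.
have sub_coprime (B : {group gT}) : B \subset H -> #|B| %| P -> B :=: 1%g.
  move=> sBH B_P; apply/eqP; rewrite trivg_card1 -dvdn1 -(eqP coP) dvdn_gcd B_P.
  by rewrite -cardH cardSg.
have abH: abelian H.
  apply/commG1P; apply: (sub_coprime H^`(1)%G); first exact: der_sub 1 H.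
  by rewrite (dvdn_trans _ A_P) ?cardSg ?dergS.
exists G^`(1)%G, H; split=> //.
  exact: subset_trans sHG (normal_norm nsAG).
apply: (sub_coprime 'C_H(_)%G); first exact: subsetIl.
set A := G^`(1)%G in abA nsAG A_P *; set C := 'C_H(A)%G.
have sCH: C \subset H := subsetIl _ _.
have cAC: C \subset 'C(A) := subsetIr _ _.
apply: (dvdn_trans (cardSg (joing_subr A C))); apply: (ito (A <*> C)%G).
  rewrite /normal join_subG (normal_sub nsAG) (subset_trans sCH) //=.
  rewrite sub_der1_norm ?joing_subl // join_subG (normal_sub nsAG).
  by rewrite (subset_trans sCH).
rewrite abelianY; apply/and3P; split; last exact: cAC; first exact: abA.
exact: abelianS abH.
Qed.

(** * Factoring a faithful coprime action of an abelian group *)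

(** For [y] in [H], the subgroup ['C_N[y]] is [H]-invariant because [H] is
    abelian, so by minimality it is trivial or [N].  Hence every nontrivial
    element of [N] has stabilizer ['C_H(N)], and [N^#] is a union of orbits of
    length [#|H : 'C_H(N)|]. *)
Lemma index_cent_dvd_minnormal (gT : finGroupType) (H N : {group gT}) :
  abelian H -> minnormal N H -> #|H : 'C_H(N)| %| #|N|.-1.
Proof.
move=> abH /mingroupP[/andP[ntN nNH] minN].
have actsH: [acts H, on N^# | 'J] by rewrite astabsJ normD1.
rewrite (cardsD1 1%g N) group1 -(acts_sum_card_orbit actsH) /=.
rewrite (eq_bigr (fun _ => #|H : 'C_H(N)|)) ?sum_nat_const ?dvdn_mull //.
move=> _ /imsetP[x /setD1P[ntx Nx] ->]; rewrite card_orbit astab1J.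
congr #|_ : _|; apply/eqP; rewrite eqEsubset andbC setIS /=; last first.
  by rewrite -cent_set1 centS ?sub1set.
apply/subsetP=> y /setIP[Hy cxy]; rewrite inE Hy /=.
have sHCy: H \subset 'C[y].
  by rewrite -cent_set1 (subset_trans abH) ?centS ?sub1set.
have /= defN: 'C_N[y]%G = N :> {set gT}.
  apply: minN; last exact: subsetIl.
  apply/andP; split; first by apply/trivgPn; exists x; rewrite // inE Nx cent1C.
  by apply: normsI => //; apply: subset_trans sHCy (normG _).
by rewrite -sub_cent1 -defN subsetIr.
Qed.

(** For such [(b, q, e)] the units of the field of order [q ^ e] have a subgroup
    of order [b], and it is the complement of a Frobenius group whose kernel is
    the additive group of the field. *)
Definition frobenius_triple (x : nat * nat * nat) : bool :=
  let: (b, q, e) := x in [&& 1 < b, prime q, 0 < e & b %| (q ^ e).-1].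

(** Induction on [#|A|]: a minimal [H]-invariant subgroup [N] of [A] yields the
    triple for [#|H : 'C_H(N)|] (none when this index is [1]), and the rest
    comes from ['C_H(N)] acting on [A / N]. *)
Lemma coprime_abelian_factors (gT : finGroupType) (A H : {group gT}) :
    abelian A -> abelian H -> H \subset 'N(A) -> coprime #|A| #|H| ->
    'C_H(A) = 1%g ->
  exists s : seq (nat * nat * nat),
    [/\ all frobenius_triple s,
        \prod_(x <- s) x.1.1 = #|H|
      & \prod_(x <- s) x.1.2 ^ x.2 %| #|A|].
Proof.
have [n] := ubnP #|A|; elim: n gT A H => // n IHn gT A H /ltnSE-leAn.
move=> abA abH nAH coAH regH.
have [A1 | ntA] := eqVneq A 1%G.
  exists [::]; rewrite !big_nil; split=> //.
  have defH: 'C_H(A) = H by apply/setIidPl; rewrite A1 cents1.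
  by rewrite -defH regH cards1.
pose invar := [pred N : {group gT} | (N :!=: 1%g) && (H \subset 'N(N))].
have [|N minN sNA] := @mingroup_exists _ invar A; first by rewrite /= ntA.
have abN := abelianS sNA abA.
have [nNH ntN abelN] := minnormal_solvable minN (subxx N) (abelian_sol abN).
have nNA: A \subset 'N(N).
  exact: subset_trans (sub_abelian_cent abA sNA) (cent_sub N).
pose C := 'C_H(N)%G.
have sCH: C \subset H := subsetIl _ _.
have nNC: C \subset 'N(N) := subset_trans sCH nNH.
have coAC: coprime #|A| #|C| := coprimegS sCH coAH.
have tiNC: N :&: C = 1%g by rewrite coprime_TIg ?(coprimeSg sNA).
have cardC: #|(C / N)%g| = #|C|.
  by rewrite -(card_isog (quotient_isog nNC tiNC)).
have [||||||s [s_ok Db Dq]] := IHn _ (A / N)%G (C / N)%G.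
- by rewrite (leq_trans _ leAn) ?ltn_quotient.
- exact: quotient_abelian.
- exact: quotient_abelian (abelianS sCH abH).
- by rewrite quotient_norms // (subset_trans sCH).
- by rewrite /= cardC (coprime_dvdl (dvdn_quotient A N)).
(* An element of C that is trivial on A / N centralizes both factors of the
   series 1 < N <= A, hence A itself since the action is coprime. *)
- pose D := (C :&: coset N @*^-1 'C((A / N)%g))%G.
  have sDC: D \subset C := subsetIl _ _.
  have cND: [~: N, D] = 1%g.
    by apply/commG1P; rewrite centsC (subset_trans sDC) ?subsetIr.
  have sADN: [~: A, D] \subset N.
    rewrite commGC -quotient_cents2 ?(subset_trans sDC) //.
    apply: subset_trans (quotientS _ (subsetIr _ _)) _.
    by rewrite cosetpreK.
  have D1: D \subset 'C_H(A).
    rewrite subsetI (subset_trans sDC) //= centsC; apply/commG1P/trivgP.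
    have nAD: D \subset 'N(A).
      by rewrite !(subset_trans _ nAH) ?(subset_trans sDC).
    rewrite -(coprime_abel_cent_TI nAD (coprimegS sDC coAC) abA).
    by rewrite subsetI subxx (subset_trans sADN) //; apply/commG1P.
  rewrite regH in D1; apply/trivgP/subsetP=> y /setIP[].
  case/morphimP=> x Nx Cx -> cAx.
  have: x \in D by rewrite inE Cx; apply/morphpreP.
  by move/(subsetP D1)/set1P->; rewrite morph1 inE.
rewrite /= cardC in Db.
have cardA: (#|(A / N)%g| * #|N|)%N = #|A|.
  by rewrite mulnC card_quotient // Lagrange.
have cardH: (#|H : C| * #|C|)%N = #|H| by rewrite mulnC Lagrange.
have [iHC | ] := leqP #|H : C| 1.
  exists s; split=> //; last by rewrite (dvdn_trans Dq) ?dvdn_quotient.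
  have/eqP iHC1: #|H : C| == 1 by rewrite eqn_leq iHC indexg_gt0.
  by rewrite -cardH iHC1 mul1n.
move=> iHC_gt1; have [q pr_q qN] := is_abelemP abelN.
have [_ _ [e De]] := pgroup_pdiv (abelem_pgroup qN) ntN.
exists ((#|H : C|, q, e.+1) :: s); rewrite /= !big_cons /= Db cardH -De.
split=> //.
  by rewrite s_ok iHC_gt1 pr_q index_cent_dvd_minnormal.
by rewrite -cardA mulnC dvdn_mul.
Qed.

(** * Counting factors *)

(** The first prime [x] of [t] divides some member [x * c] of [s].  Replace this
    member by [c], or drop it when [c = 1], and cancel [x] on both sides. *)
Lemma size_factorization_le (s t : seq nat) :
  all (fun b => 1 < b) s -> all prime t ->
  \prod_(b <- s) b = \prod_(x <- t) x -> size s <= size t.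
Proof.
elim: t s => [|x t IHt] s gt1s /= => [_|/andP[pr_x pr_t]].
  case: s gt1s => //= b s /andP[b_gt1 _]; rewrite big_cons big_nil => /eqP.
  by rewrite muln_eq1 => /andP[/eqP b1]; rewrite b1 in b_gt1.
rewrite big_cons => Ds.
have: x %| \prod_(b <- s) b by rewrite Ds dvdn_mulr.
rewrite Euclid_dvd_prod // big_has => /hasP[b sb /dvdnP[c Db]].
rewrite /= mulnC in Db.
have Dp := perm_to_rem sb.
rewrite (perm_size Dp) /=; rewrite (perm_all _ Dp) /= in gt1s.
rewrite (perm_big _ Dp) big_cons /= {1}Db -mulnA in Ds.
move/eqP: Ds; rewrite eqn_pmul2l ?prime_gt0 // => /eqP Ds.
have [b_gt1 gt1r] := andP gt1s; rewrite ltnS.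
have [c_gt1 | c_le1] := ltnP 1 c.
  by apply: ltnW; apply: (IHt (c :: rem b s)); rewrite ?big_cons /= ?c_gt1.
apply: IHt => //; rewrite -Ds; case: c c_le1 Db {Ds} => [|[|//]] _.
  by move=> Db; rewrite Db muln0 in b_gt1.
by rewrite mul1n.
Qed.

(** * Realizing degrees *)

Definition metabelian_realizable (N d : nat) : Prop :=
  exists (gT : finGroupType) (G : {group gT}),
    [/\ metabelian G, #|G| = N & d \in cd G].

Lemma isog_cd (aT rT : finGroupType) (G : {group aT}) (R : {group rT}) d :
  G \isog R -> d \in cd G -> d \in cd R.
Proof.
case/isogP=> f injf defR /existsP[i /eqP Di]; apply/existsP.
have isoG: isom G R f by apply/isomP.
by exists (isom_Iirr isoG i); rewrite isom_IirrE cfIsom1 Di.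
Qed.

Lemma metabelian_realizable_mul N1 d1 N2 d2 :
  metabelian_realizable N1 d1 -> metabelian_realizable N2 d2 ->
  metabelian_realizable (N1 * N2) (d1 * d2).
Proof.
move=> [gT1 [G1 [mG1 <- d1G1]]] [gT2 [G2 [mG2 <- d2G2]]].
exists (gT1 * gT2)%type, (setX G1 G2)%G.
have defG := setX_dprod G1 G2.
have := sub_isog (subsetT G1) (injm_pairg1 gT1 gT2).
rewrite morphim_pairg1 => iso1.
have := sub_isog (subsetT G2) (injm_pair1g gT1 gT2).
rewrite morphim_pair1g => iso2.
split; last 1 first.
- have /existsP[i /eqP Di] := isog_cd iso1 d1G1.
  have /existsP[j /eqP Dj] := isog_cd iso2 d2G2.
  apply/existsP; exists (dprod_Iirr defG (i, j)).
  by rewrite dprod_IirrE cfDprod1 Di Dj natrM.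
- have /dprodP[_ defG' cG12 _] := der_dprod 1 defG.
  rewrite /metabelian /= -defG' abelianM cG12.
  have /isog_abelian <- := isog_der 1 iso1.
  have /isog_abelian <- := isog_der 1 iso2.
  by apply/and3P.
by rewrite cardsX.
Qed.

Lemma metabelian_realizable1 N : 0 < N -> metabelian_realizable N 1.
Proof.
case: N => // N _; exists 'I_N.+1, [set: 'I_N.+1]%G; split.
- by rewrite /metabelian (abelianS (der_sub 1 _)) ?FinRing.zmod_abelian.
- by rewrite cardsT card_ord.
by apply/existsP; exists 0%R; rewrite irr0 cfun11.
Qed.

(** For [b > 1] the group is [F ><| U], with [F] the additive group of the field
    of order [q ^ e] and [U] a multiplicative subgroup of order [b]: a Frobenius
    group in which every nontrivial linear character of the kernel induces
    irreducibly. *)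
Lemma affine_realizable q e b :
  prime q -> 0 < e -> 0 < b -> b %| (q ^ e).-1 ->
  metabelian_realizable (q ^ e * b) b.
Proof.
move=> pr_q e_gt0 b_gt0 b_dvd.
have [b1 | b_neq1] := eqVneq b 1.
  by rewrite b1 muln1; apply: metabelian_realizable1; rewrite expn_gt0 prime_gt0.
have [F _ cardF] := pPrimePowerField pr_q e_gt0.
have [U cardU]: exists U : {group {unit F}}, #|U| = b.
  have /cyclicP[u defU] := field_unit_group_cyclic [set: {unit F}]%G.
  have ordu: #[u] = (q ^ e).-1 by rewrite orderE -defU card_finField_unit cardF.
  exists <[u ^+ (#[u] %/ b)]>%G.
  rewrite -[LHS]/#[_] orderXdiv ?dvdn_div ?ordu //.
  by rewrite divnA // mulKn // -ordu order_gt0.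
pose to := FinRing.unit_groupAction F.
have defT := sdprod_sdpair to.
set K := (sdpair1 to @* _)%g in defT; set V := (sdpair2 to @* _)%g in defT.
pose H := (sdpair2 to @* U)%G.
have sHV: H \subset V by rewrite morphimS ?subsetT.
have defG := sdprod_subr defT sHV.
have cardK: #|K| = q ^ e.
  by rewrite card_injm ?injm_sdpair1 //= cardsT cardF.
have cardH: #|H| = b by rewrite card_injm ?injm_sdpair2 ?subsetT.
have abK: abelian K by rewrite morphim_abelian ?FinRing.zmod_abelian.
have abH: abelian H.
  by rewrite morphim_abelian ?cyclic_abelian ?field_unit_group_cyclic.
set G := (K <*> H)%G.
have ntK: K :!=: 1%g.
  by rewrite -cardG_gt1 cardK -(exp1n e) ltn_exp2r ?prime_gt1.
have ntH: H :!=: 1%g.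
  by rewrite -cardG_gt1 cardH ltn_neqAle eq_sym b_neq1.
have semireg: semiregular K H.
  move=> y /setD1P[nty /morphimP[u Du Uu Dy]]; apply/trivgP/subsetP=> x.
  case/setIP=> /morphimP[a Da _ ->] /cent1P cxy; rewrite inE.
  apply: contraR nty => nta.
  have: sdpair1 to (to a u) = sdpair1 to a.
    by rewrite sdpair_act // /conjg -Dy cxy mulKg.
  have a_nz: (a != 0 :> F)%R.
    by apply: contraNneq nta => ->; rewrite morph1.
  move/(injmP (injm_sdpair1 to)) => /(_ (in_setT _) (in_setT _)) /=.
  rewrite /FinRing.unit_act -[RHS]mulr1 => /(mulfI a_nz) u1.
  by rewrite Dy (_ : u = 1%g) ?morph1 //; apply: val_inj.
have frobG: [Frobenius G = K ><| H] by apply/Frobenius_semiregularP.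
have frobGK := FrobeniusWker frobG.
have [nsKG _ _ _ _] := sdprod_context defG.
exists _, G; split.
- rewrite /metabelian (abelianS _ abK) // der1_min ?normal_norm //.
  by rewrite -(isog_abelian (sdprod_isog defG)).
- by rewrite -(sdprod_card defG) cardK cardH.
have /irrP[i Di] := irr_induced_Frobenius_ker frobGK (Iirr1_neq0 ntK).
apply/existsP; exists i; rewrite -Di cfInd1 ?normal_sub //.
rewrite lin_char1 ?mulr1; last by apply/char_abelianP.
by rewrite -divgS ?normal_sub // -(sdprod_card defG) mulKn // cardH.
Qed.

(** * The equivalence *)

Theorem mainTheorem1 (m n : nat) (d : 'I_m -> nat) (p a : 'I_n -> nat)
    (m_gt0 : 0 < m) (n_gt0 : 0 < n)
    (d_prime : forall i, prime (d i)) (p_prime : forall j, prime (p j))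
    (d_inj : injective d) (p_inj : injective p)
    (d_neq_p : forall i j, d i <> p j)
    (a_gt0 : forall j, 0 < a j) :
  (exists (gT : finGroupType) (G : {group gT}),
     [/\ metabelian G,
         #|G| = (\prod_(i < m) d i) * \prod_(j < n) p j ^ a j
       & (\prod_(i < m) d i) \in cd G])
  <->
  (exists k : nat, 0 < k <= m /\
   exists eps b q : 'I_k -> nat,
     [/\ forall r, [/\ 0 < eps r, 0 < b r & prime (q r)],
         forall r, q r ^ eps r = 1 %[mod b r],
         \prod_(r < k) b r = \prod_(i < m) d i
       & (\prod_(r < k) q r ^ eps r) %| \prod_(j < n) p j ^ a j]).
Proof.
set D := \prod_(i < m) d i; set P := \prod_(j < n) p j ^ a j.
have dvd_pred q e b : prime q -> (b %| (q ^ e).-1) = (q ^ e == 1 %[mod b]).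
  by move=> pr_q; rewrite eqn_mod_dvd ?subn1 // expn_gt0 prime_gt0.
split.
- case=> gT [G [mG cardG dG]].
  have coDP: coprime D P.
    apply: (big_ind (coprime^~ P)) => [|x y cx cy|i _].
    - exact: coprime1n.
    - by rewrite coprimeMl cx.
    apply: (big_ind (coprime (d i))) => [|x y cx cy|j _].
    - exact: coprimen1.
    - by rewrite coprimeMr cx.
    by rewrite coprimeXr // prime_coprime // dvdn_prime2 //; apply/eqP.
  have [A [H [[abA abH] nAH cardH A_P regH]]] :=
    metabelian_coprime_degree mG cardG coDP dG.
  have coAH: coprime #|A| #|H|.
    by rewrite cardH coprime_sym (coprime_dvdr A_P).
  have [s [s_ok Db Dq]] := coprime_abelian_factors abA abH nAH coAH regH.
  rewrite cardH in Db.
  have Dd: D = \prod_(x <- codom d) x by rewrite /D /codom big_map big_enum.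
  have s_size: size s <= m.
    have := @size_factorization_le [seq x.1.1 | x <- s] (codom d).
    rewrite size_map size_codom card_ord big_map -Dd; apply=> //.
      by rewrite all_map; apply: sub_all s_ok => -[[b q] e] /and4P[].
    by apply/allP=> _ /codomP[i ->].
  have D_gt1: 1 < D.
    rewrite /D (bigD1 (Ordinal m_gt0)) //=.
    apply: leq_trans (prime_gt1 (d_prime (Ordinal m_gt0))) _.
    by rewrite leq_pmulr // prodn_gt0 // => i; rewrite prime_gt0.
  have s_gt0: 0 < size s.
    by case: s Db {s_ok Dq s_size} D_gt1 => //; rewrite big_nil => <-.
  exists (size s); split; first by rewrite s_gt0.
  pose x r := nth (0, 0, 0) s r.
  exists (fun r : 'I_(size s) => (x r).2), (fun r : 'I_(size s) => (x r).1.1),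
         (fun r : 'I_(size s) => (x r).1.2).
  have x_ok (r : 'I_(size s)) : frobenius_triple (x r).
    by rewrite (all_nthP _ s_ok).
  split=> [r | r | |].
  + case: (x r) (x_ok r) => [[b q] e] /and4P[b1 pr_q e_gt0 _].
    by rewrite (ltnW b1).
  + case: (x r) (x_ok r) => [[b q] e] /and4P[_ pr_q _].
    by rewrite dvd_pred // => /eqP.
  + by rewrite -Db (big_nth (0, 0, 0)) big_mkord.
  by rewrite (big_nth (0, 0, 0)) big_mkord in Dq; apply: dvdn_trans Dq A_P.
case=> k [_ [eps [b [q [pos eqmod Db /dvdnP[c Dc]]]]]].
have realized: metabelian_realizable
    (\prod_(r < k) (q r ^ eps r * b r)) (\prod_(r < k) b r).
  apply: (big_ind2 metabelian_realizable) => [|N1 d1 N2 d2|r _].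
  - exact: metabelian_realizable1.
  - exact: metabelian_realizable_mul.
  have [eps_gt0 b_gt0 pr_q] := pos r.
  by apply: affine_realizable; rewrite // dvd_pred // eqmod.
have c_gt0: 0 < c.
  have: 0 < P by apply: prodn_gt0 => j; rewrite expn_gt0 prime_gt0.
  by rewrite Dc muln_gt0 => /andP[].
have := metabelian_realizable_mul realized (metabelian_realizable1 c_gt0).
rewrite big_split /= Db muln1.
by have <-: D * P = \prod_(r < k) q r ^ eps r * D * c
  by rewrite Dc mulnCA mulnC (mulnC D).
Qed.
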